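(* Let $S$ be the semigroup defined by the presentation $\langle a, b \mid ab^2=b,\ aba=a^2b\rangle$, and let $A=\langle a\rangle$ be the subsemigroup of $S$ generated by $a$. Then $S\setminus A$ is the minimal (two-sided) ideal $\mathcal{K}(S)$ of $S$; the semigroup $S$ is right noetherian; and $\mathcal{K}(S)$, regarded as a semigroup, is not right noetherian. In particular, there exists a right noetherian semigroup with a minimal ideal that is not right noetherian.
   Context: A right ideal of a semigroup $T$ is a subset $I\subseteq T$ with $IT\subseteq I$; left ideals are defined dually, and an ideal is a subset that is both a right and a left ideal. A semigroup $T$ is right noetherian if its poset of right ideals (under containment) satisfies the ascending chain condition, i.e. every ascending chain $I_1\subseteq I_2\subseteq\cdots$ of right ideals eventually stabilises. A minimal ideal of $S$ is an ideal properly containing no ideal of $S$ (ideals being non-empty here); if it exists it is unique, is called the kernel of $S$, and is denoted $\mathcal{K}(S)$. *)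

(* Defs.v *)
From HB Require Import structures.
From mathcomp Require Import all_boot.
From mathcomp Require Import boolp classical_sets.

Set Implicit Arguments.
Unset Strict Implicit.
Unset Printing Implicit Defensive.

Local Open Scope classical_set_scope.
Local Open Scope quotient_scope.
Local Open Scope group_scope.

Section Ideals.
Variable T : semigroupType.
Implicit Types I J K : set T.

Definition subsemigroup (B : set T) := forall x y, B x -> B y -> B (x * y).

Definition gen_subsemigroup (G : set T) : set T := smallest subsemigroup G.

Definition right_ideal I := forall x y, I x -> I (x * y).

Definition left_ideal I := forall x y, I x -> I (y * x).

(* One-sided ideals may be empty (this is immaterial for the ascending chain
   condition), two-sided ideals may not (else set0 would always be the only
   minimal ideal). *)
Definition ideal I := [/\ I !=set0, right_ideal I & left_ideal I].

Definition minimal_ideal K :=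
  ideal K /\ forall J, ideal J -> ~ (J `<` K).

Lemma ideal_subsemigroup I : ideal I -> subsemigroup I.
Proof. by case=> _ rI _ x y Ix _; exact: rI. Qed.

Lemma minimal_ideal_subsemigroup K : minimal_ideal K -> subsemigroup K.
Proof. by case=> /ideal_subsemigroup. Qed.

Lemma idealI I J : ideal I -> ideal J -> ideal (I `&` J).
Proof.
move=> [[x Ix] rI lI] [[y Jy] rJ lJ]; split.
- by exists (x * y); split; [exact: rI|exact: lJ].
- by move=> u v [Iu Ju]; split; [exact: rI|exact: rJ].
- by move=> u v [Iu Ju]; split; [exact: lI|exact: lJ].
Qed.

Lemma minimal_ideal_unique K L : minimal_ideal K -> minimal_ideal L -> K = L.
Proof.
have sub M N : minimal_ideal M -> minimal_ideal N -> M `<=` N.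
  move=> [iM minM] [iN _] x Mx; apply: contrapT => nNx.
  apply: (minM (M `&` N)); first exact: idealI.
  by split; [exact: subIsetl|move=> /(_ x Mx) []].
by move=> mK mL; apply/seteqP; split; apply: sub.
Qed.

Definition right_noetherian :=
  forall I : nat -> set T,
    (forall n, right_ideal (I n)) -> (forall n, I n `<=` I n.+1) ->
    exists N, forall n, (N <= n)%N -> I n = I N.

End Ideals.

Section SubSemigroup.
Variables (T : semigroupType) (B : set T) (hB : subsemigroup B).

(* The proof hB is a parameter of the type so that the multiplication can be
   inferred from it. *)
Definition sub_semigroup of subsemigroup B := set_type B.

Local Notation S := (sub_semigroup hB).

HB.instance Definition _ := SubChoice.copy S (set_type B).

Fact sub_semigroup_closed : mulg_closed (mem B).
Proof.
move=> x y /set_mem Bx /set_mem By; apply/mem_set; exact: hB.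
Qed.

HB.instance Definition _ :=
  SubChoice_isSubSemigroup.Build T (mem B) S sub_semigroup_closed.

End SubSemigroup.

(* The free semigroup on X: non-empty words under concatenation. *)
Definition word (X : choiceType) := {w : seq X | w != [::]}.

Section Words.
Variable X : choiceType.

HB.instance Definition _ := SubChoice.on (word X).

Fact cat_neq_nil (u v : word X) : val u ++ val v != [::].
Proof. by case: u => -[]. Qed.

Definition word_mul (u v : word X) : word X := Sub (val u ++ val v) (cat_neq_nil u v).

Fact word_mulA : associative word_mul.
Proof. by move=> u v w; apply: val_inj; rewrite /= catA. Qed.

HB.instance Definition _ := isSemigroup.Build (word X) word_mulA.

Definition letter (x : X) : word X := Sub [:: x] isT.

End Words.

Section Presentation.
Variables (X : choiceType) (R : set (word X * word X)).

(* The congruence on the free semigroup generated by R. *)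
Inductive pres_cong : word X -> word X -> Prop :=
| pres_cong_rel u v : R (u, v) -> pres_cong u v
| pres_cong_refl u : pres_cong u u
| pres_cong_sym u v : pres_cong u v -> pres_cong v u
| pres_cong_trans v u w : pres_cong u v -> pres_cong v w -> pres_cong u w
| pres_cong_mul u u' v v' :
    pres_cong u u' -> pres_cong v v' -> pres_cong (u * v) (u' * v').

Definition pres_rel : rel (word X) := fun u v => `[< pres_cong u v >].

Fact pres_rel_refl : reflexive pres_rel.
Proof. by move=> u; apply/asboolP; exact: pres_cong_refl. Qed.

Fact pres_rel_sym : symmetric pres_rel.
Proof. by move=> u v; apply/asboolP/asboolP; exact: pres_cong_sym. Qed.

Fact pres_rel_trans : transitive pres_rel.
Proof.
by move=> v u w /asboolP uv /asboolP vw; apply/asboolP/(pres_cong_trans uv vw).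
Qed.

Canonical pres_equiv := EquivRel pres_rel pres_rel_refl pres_rel_sym
  pres_rel_trans.

(* The semigroup < X | R >. *)
Definition presented := {eq_quot pres_equiv}.

HB.instance Definition _ := Choice.on presented.
HB.instance Definition _ := EqQuotient.on presented.

Definition presented_class (u : word X) : presented := \pi_presented u.

Lemma presented_classP u v :
  presented_class u = presented_class v <-> pres_cong u v.
Proof.
split=> [/eqmodP/asboolP //|uv]; by apply/eqmodP/asboolP.
Qed.

Definition presented_mul (x y : presented) : presented :=
  presented_class (repr x * repr y).

Lemma presented_class_mul u v :
  presented_mul (presented_class u) (presented_class v) =
  presented_class (u * v).
Proof.
apply/presented_classP; apply: pres_cong_mul; apply/presented_classP;
  exact: reprK.
Qed.

Fact presented_mulA : associative presented_mul.
Proof.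
have classK x : presented_class (repr x) = x by exact: reprK.
move=> x y z; rewrite -(classK x) -(classK y) -(classK z).
by rewrite !presented_class_mul mulgA.
Qed.

HB.instance Definition _ := isSemigroup.Build presented presented_mulA.

End Presentation.

Section Example.
Local Notation a := (letter false).
Local Notation b := (letter true).

(* < a, b | a b^2 = b, a b a = a^2 b >, with letters a := false, b := true. *)
Definition Sab : semigroupType :=
  presented [set (a * (b * b), b); (a * b * a, a * a * b)].

Definition Sab_a : Sab := presented_class _ a.

End Example.

(* Main.v *)
From HB Require Import structures.
From mathcomp Require Import all_boot.
From mathcomp Require Import boolp classical_sets.
Require Import Defs.

Local Open Scope classical_set_scope.

(** Write [e = ab].  The relations give [e b = b] and [e a = a e], hence
    [e e = e]; so left multiplication by [e] fixes every word containing the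
    letter [b] and commutes with powers of [a].  Hence [S \ A = eS], and this
    is an ideal ([kernel_ideal]).

    Every element of [S] is [g_m a^j] for the sequence
    [a, ab, b, bab, bb, bbab, bbb, ...] of elements [g_m] ([spine], [spine_form]),
    and [g_(m+1)] is always a right multiple of [g_m a^j] ([spine_step]).  So
    right divisibility contains the lexicographic order on the pairs [(m, j)],
    which is a well-order: every non-empty right ideal of [S] is principal
    ([right_ideal_principal]) and [S] is right noetherian.  Left multiplication
    by [a] moves two steps back along [ab, b, bab, ...] and sends [b] to [e], so
    every ideal of [S] contains [e], hence [eS], which is therefore minimal.

    In [eS] the generator [a] is not available on the right: one has
    [b a^j (eS) = b a^(j+1) b S], which contains no [b a^k].  The sets formed by
    [b a^j] for [j < n], together with everything divisible on the left by [b]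
    and not of the form [b a^k], are then right ideals of [eS] and increase
    strictly with [n].  That the elements [b a^k] are distinct and not in
    [b a^j (eS)] is read off a right action of [S] on an infinite set of
    states ([step], [act]). *)

Section Proof.
Local Open Scope group_scope.

(** * The relations and right multiplication by words *)

Definition cls (u : word bool) : Sab := presented_class _ u.

Definition Sab_b : Sab := cls (letter true).

Local Notation a := Sab_a.
Local Notation b := Sab_b.
Local Notation e := (Sab_a * Sab_b).

(** The carrier of [Sab] mentions products of words; fixing the type confines
    rewriting to products in [Sab]. *)
Lemma SabA (x y z : Sab) : x * (y * z) = x * y * z.
Proof. exact: mulgA. Qed.

Lemma cls_mul u v : cls (u * v) = cls u * cls v.
Proof. exact/esym/presented_class_mul. Qed.

Lemma cls_repr x : cls (repr x) = x.
Proof. exact: reprK. Qed.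

Lemma eb : e * b = b.
Proof.
have : cls (letter false * (letter true * letter true)) = cls (letter true).
  by apply/presented_classP/pres_cong_rel; left.
by rewrite 2!cls_mul SabA.
Qed.

Lemma ea : e * a = a * e.
Proof.
have : cls (letter false * letter true * letter false) =
       cls (letter false * letter false * letter true).
  by apply/presented_classP/pres_cong_rel; right.
by rewrite !cls_mul -SabA => ->; rewrite SabA.
Qed.

Lemma abb x : x * a * b * b = x * b.
Proof. by rewrite -(SabA x) -SabA eb. Qed.

Lemma ee : e * e = e.
Proof. by rewrite SabA ea -SabA eb. Qed.

Definition gen (c : bool) : Sab := if c then b else a.

(** [S] has no identity element, so an expression [x w] with [w] a possibly
    empty word is written as the action of [w] on [x]. *)
Definition run (x : Sab) (w : seq bool) : Sab :=
  foldl (fun y c => y * gen c) x w.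

Lemma run_cat x u v : run x (u ++ v) = run (run x u) v.
Proof. exact: foldl_cat. Qed.

Lemma run_mul x y w : run (x * y) w = x * run y w.
Proof. by elim: w y => //= c w IH y; rewrite -SabA IH. Qed.

Lemma right_ideal_run (I : set Sab) x w : right_ideal I -> I x -> I (run x w).
Proof. by move=> rI; elim: w x => //= c w IH x Ix; apply/IH/rI. Qed.

(** Induction on a word representing [x], from left to right. *)
Lemma Sab_ind (P : Sab -> Prop) :
  P a -> P b -> (forall x, P x -> P (x * a)) -> (forall x, P x -> P (x * b)) ->
  forall x, P x.
Proof.
move=> Pa Pb Pra Prb x.
rewrite -(cls_repr x); case: (repr x) => -[//|c w] wN.
have Prun y v : P y -> P (run y v).
  by elim: v y => //= -[] v IH y Py; apply: IH; [apply: Prb|apply: Pra].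
suff -> : cls (exist _ (c :: w) wN) = run (gen c) w.
  by apply: Prun; case: c {wN}.
elim/last_ind: w wN => [|w d IH] wN.
  by case: c wN => wN; congr cls; apply: val_inj.
rewrite -cats1 run_cat -(IH isT) /=.
have -> : gen d = cls (letter d) by case: d {wN}.
rewrite -cls_mul; congr cls; apply: val_inj => /=.
by rewrite cats1.
Qed.

(** * The spine and the right ideals *)

(** The sequence [a, ab, b, bab, bb, bbab, bbb, ...]: from the second term on,
    left multiplication by [b] moves two steps forward. *)
Fixpoint spine (m : nat) : Sab :=
  match m with
  | 0 => a
  | 1 => e
  | 2 => b
  | (m'.+1 as k).+2 => b * spine k
  end.

Lemma spine3 m : spine m.+3 = b * spine m.+1. Proof. by []. Qed.

Local Notation pow_a j := (nseq j false).
Local Notation pow_b j := (nseq j true).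

Lemma spine_parity (P : nat -> Prop) :
  P 0%N -> P 1%N -> P 2%N -> (forall m, P m.+1 -> P m.+3) -> forall m, P m.
Proof.
move=> P0 P1 P2 PS m.
suff: [/\ P m, P m.+1 & P m.+2] by case.
elim: m => [|m [Pm Pm1 Pm2]]; first by [].
by split=> //; apply: PS.
Qed.

(** [a a^k b = (ab) a^k] because [ab] commutes with [a]. *)
Lemma run_a_b k : run a (pow_a k ++ [:: true]) = run e (pow_a k).
Proof.
elim: k => //= k IH.
by rewrite run_mul IH -run_mul -ea.
Qed.

Lemma nseqSr (c : bool) k : nseq k.+1 c = nseq k c ++ [:: c].
Proof. by rewrite -addn1 nseqD. Qed.

Lemma run_a_bpow j : run a (pow_a j ++ pow_b j.+1) = e.
Proof.
elim: j => [//|j IH].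
rewrite (nseqSr true) catA run_cat.
rewrite -[run a _]/(run (a * a) (pow_a j ++ pow_b j.+1)).
by rewrite run_mul IH /= SabA abb.
Qed.

Lemma run_e_bpow j : run e (pow_a j ++ pow_b j.+1) = b.
Proof.
rewrite run_cat -run_a_b -run_cat -catA -[[:: true] ++ _]/(pow_b j.+2).
by rewrite (nseqSr true) catA run_cat run_a_bpow /= eb.
Qed.

(** On the first three terms this rests on [a a^j b^(j+1) = ab] and
    [ab a^j b^(j+1) = b]; left multiplication by [b] gives the others. *)
Lemma spine_step m j : exists w, spine m.+1 = run (spine m) (pow_a j ++ w).
Proof.
elim/spine_parity: m => [|||m [w IH]].
- by exists (pow_b j.+1); rewrite run_a_bpow.
- by exists (pow_b j.+1); rewrite run_e_bpow.
- exists (false :: pow_b j.+1).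
  rewrite -[false :: _]/([:: false] ++ _) catA -(nseqSr false) spine3.
  by rewrite -[spine 1](run_a_bpow j) -run_mul.
- by exists w; rewrite !spine3 IH run_mul.
Qed.

(** The term [a] of the spine is left out here because [b a] is not the term
    two steps further, whereas this set is stable under left multiplication by
    [b]. *)
Definition spine_multiples : set Sab :=
  [set x | exists m j, x = run (spine m.+1) (pow_a j)].

Lemma spine_multiples_mulb x :
  spine_multiples x -> spine_multiples (b * x).
Proof. by move=> [m [j ->]]; exists m.+2, j; rewrite spine3 run_mul. Qed.

(** Only right multiplication by [b] needs an argument: a final block
    [a^(k+1) b] is rewritten as [ab a^k], and [a b b] is shortened to [b]. *)
Lemma spine_form x : exists m j, x = run (spine m) (pow_a j).
Proof.
suff mulb m j : spine_multiples (run (spine m) (pow_a j) * b).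
  elim/Sab_ind: x => [|| x [m [j ->]]|x [m [j ->]]].
  - by exists 0%N, 0%N.
  - by exists 2%N, 0%N.
  - by exists m, j.+1; rewrite nseqSr run_cat.
  - by have [m' [j' ->]] := mulb m j; exists m'.+1, j'.
elim/spine_parity: m => [|||m].
- by exists 0%N, j; rewrite -run_a_b run_cat.
- rewrite -run_a_b run_cat /=; case: j => [|k].
    by exists 1%N, 0%N; rewrite eb.
  exists 0%N, k; rewrite nseqSr run_cat /= abb.
  by rewrite -run_a_b run_cat.
- case: j => [|k]; first by exists 3%N, 0%N.
  exists 2%N, k; rewrite spine3 -[spine 1]/e run_mul -run_a_b -run_mul.
  by rewrite run_cat.
- by move=> /spine_multiples_mulb; rewrite run_mul SabA.
Qed.

(** Raising [m] is [spine_step], raising [j] is right multiplication by [a]; so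
    a right ideal is upward closed for the lexicographic order on [(m, j)]. *)
Lemma right_ideal_spine (I : set Sab) m j m' j' :
  right_ideal I -> (m < m')%N || (m == m') && (j <= j')%N ->
  I (run (spine m) (pow_a j)) -> I (run (spine m') (pow_a j')).
Proof.
move=> rI /orP[mm' Ix|/andP[/eqP<- jj'] Ix]; last first.
  by rewrite -(subnKC jj') nseqD run_cat; apply: right_ideal_run.
apply: right_ideal_run => //.
elim: m' mm' => // m' IH; rewrite ltnS leq_eqVlt => /orP[/eqP<-|/IH Im'].
  by have [w ->] := spine_step m j; rewrite run_cat; apply: right_ideal_run.
by have [w ->] := spine_step m' 0%N; apply: right_ideal_run.
Qed.

(** The generator is the lexicographically least [g_m a^j] in the ideal. *)
Lemma right_ideal_principal (I : set Sab) :
  right_ideal I -> I !=set0 ->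
  exists2 x, I x & forall J, right_ideal J -> J x -> I `<=` J.
Proof.
move=> rI [y Iy].
pose inI m j := `[< I (run (spine m) (pow_a j)) >].
have exm : exists m, `[< exists j, inI m j >].
  have [m [j yE]] := spine_form y; exists m; apply/asboolP; exists j.
  by apply/asboolP; rewrite -yE.
case: (ex_minnP exm) => m /asboolP exj minm.
case: (ex_minnP exj) => j /asboolP Ix minj.
exists (run (spine m) (pow_a j)) => // J rJ Jx z Iz.
have [m' [j' zE]] := spine_form z; rewrite zE in Iz *.
apply: right_ideal_spine Jx => //.
have /minm : `[< exists j, inI m' j >] by apply/asboolP; exists j'; apply/asboolP.
rewrite leq_eqVlt => /orP[/eqP mm'|->//]; rewrite mm' eqxx /=.
by apply/orP; right; apply: minj; rewrite mm'; apply/asboolP.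
Qed.

(** The union of the chain is principal, and the chain stops as soon as it
    contains the generator. *)
Lemma right_noetherian_Sab : right_noetherian Sab.
Proof.
move=> I rI Iinc.
have Imono m n : (m <= n)%N -> I m `<=` I n.
  move=> /subnKC <-; elim: (n - m)%N => [|k IH]; first by rewrite addn0.
  by rewrite addnS; apply: subset_trans (Iinc _).
have [[y [n0 In0y]]|I0] := pselect (exists y n, I n y); last first.
  exists 0%N => n _; apply/seteqP.
  by split=> x Ix; case: I0; exists x; eexists; exact: Ix.
have rU : right_ideal [set x | exists n, I n x].
  by move=> x z [n Inx]; exists n; apply: rI.
have [|x [N INx] xgen] := right_ideal_principal _ rU; first by exists y, n0.
exists N => n Nn; apply/seteqP; split; last exact: Imono.
by move=> z Inz; apply: (xgen (I N)) => //; exists n.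
Qed.

(** * A right action separating the elements [b a^k] *)

(** Orienting the relations as [abb -> b] and [aba -> aab], a state records the
    normal form of the word read so far: [Apow n] is [a^n] ([Apow 0] is the
    initial state), [ApowB n] is [a^(n+1) b], [BApow n] is [b a^n] and [Sink]
    is any other normal form. *)
Inductive state := Apow of nat | ApowB of nat | BApow of nat | Sink.

Definition step (s : state) (c : bool) : state :=
  match s with
  | Apow n =>
      if c then if n is n'.+1 then ApowB n' else BApow 0 else Apow n.+1
  | ApowB n =>
      if c then if n is n'.+1 then ApowB n' else BApow 0 else ApowB n.+1
  | BApow n => if c then Sink else BApow n.+1
  | Sink => Sink
  end.

Definition act (s : state) (x : Sab) : state := foldl step s (val (repr x)).

(** The two relations hold for the transitions out of every state, so the
    action of words is compatible with the congruence. *)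
Lemma act_cls s u : act s (cls u) = foldl step s (val u).
Proof.
have /presented_classP := cls_repr (cls u).
rewrite /act; set r := repr _; move: r => r uv; elim: uv s => {u r}.
- by move=> u v [] [-> ->] [[|n]|[|n]|n|].
- by [].
- by move=> u v _ IH s; rewrite IH.
- by move=> v u w _ IH1 _ IH2 s; rewrite IH1.
- by move=> u u' v v' _ IH1 _ IH2 s; rewrite /= !foldl_cat IH1 IH2.
Qed.

Lemma act_mul s x y : act s (x * y) = act (act s x) y.
Proof.
rewrite -[in LHS](cls_repr x) -[in LHS](cls_repr y) -cls_mul act_cls.
exact: foldl_cat.
Qed.

Lemma act_a s : act s a = step s false. Proof. exact: act_cls. Qed.

Lemma act_b s : act s b = step s true. Proof. exact: act_cls. Qed.

Definition act_gen := (act_a, act_b).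

Lemma act_Sink x : act Sink x = Sink.
Proof.
by elim/Sab_ind: x => [|| x IH | x IH]; rewrite ?act_mul ?IH act_gen.
Qed.

Lemma act_e_BApow n x : act (BApow n) (e * x) = Sink.
Proof. by rewrite !act_mul !act_gen /= act_Sink. Qed.

(** * The kernel *)

Local Notation A := (gen_subsemigroup [set a]).

Lemma gen_ind (P : set Sab) : subsemigroup P -> P a -> A `<=` P.
Proof. by move=> sP Pa x; apply; split=> // _ ->. Qed.

Lemma A_commute_e x : A x -> e * x = x * e.
Proof.
apply: (gen_ind [set x | e * x = x * e]); last exact: ea.
by move=> y z /= ey ez; rewrite SabA ey -SabA ez SabA.
Qed.

Lemma A_act x : A x -> forall n, exists k, act (Apow n) x = Apow k.
Proof.
apply: (gen_ind [set x | forall n, exists k, act (Apow n) x = Apow k]).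
  move=> y z Ay Az n; have [k yE] := Ay n; have [l zE] := Az k.
  by exists l; rewrite act_mul yE.
by move=> n; exists n.+1; rewrite act_a.
Qed.

(** Once the letter [b] has been read, the state never returns to [Apow]. *)
Lemma act_e_Apow x : forall n k, act (Apow n) (e * x) <> Apow k.
Proof.
pose noA s := if s is Apow _ then False else True.
suff noA_act s : noA s -> noA (act s x).
  move=> n k nk; have := noA_act (act (Apow n) e); rewrite -act_mul nk.
  by apply; rewrite act_mul !act_gen.
have noA_step t c : noA t -> noA (step t c) by case: t c => [n|[|n]|n|] [].
by elim/Sab_ind: x s => [||x IH|x IH] s As; rewrite ?act_mul act_gen;
  apply: noA_step; rewrite ?act_mul; try exact: IH.
Qed.

(** [S \ A] is [eS]: as [e b = b] and [e] commutes with [A], it fixes every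
    product in which [b] occurs. *)
Lemma kernelP x : (~` A) x <-> e * x = x.
Proof.
split=> [nAx|ex Ax]; last first.
  by have [k] := A_act _ Ax 0; rewrite -ex; apply: act_e_Apow.
have Aa : A a by move=> P [_]; apply.
have AM y z : A y -> A z -> A (y * z).
  by move=> Ay Az P PP; case: (PP) => sP _; apply: sP; [apply: Ay|apply: Az].
suff [//|] : A x \/ e * x = x by [].
elim/Sab_ind: x {nAx} => [||x [Ax|ex]|x [Ax|ex]].
- by left.
- by right; rewrite eb.
- by left; apply: AM.
- by right; rewrite SabA ex.
- by right; rewrite SabA A_commute_e // -SabA eb.
- by right; rewrite SabA ex.
Qed.

Lemma kernel_ideal : ideal (~` A).
Proof.
split; first by exists b; apply/kernelP/eb.
  by move=> x y /kernelP ex; apply/kernelP; rewrite SabA ex.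
move=> x y /kernelP ex; apply/kernelP.
have [Ay|/kernelP ey] := pselect (A y); last by rewrite SabA ey.
by rewrite SabA A_commute_e // -SabA ex.
Qed.

(** Left multiplication by [a] turns [b g_m], for [m > 0], into [e g_m = g_m], which lowers
    the index on the spine by two, down to [e] or [b]; and [a b = e]. *)
Lemma left_ideal_spine (J : set Sab) m :
  left_ideal J -> J (spine m.+1) -> J e.
Proof.
move=> lJ.
have e_spine k : e * spine k.+1 = spine k.+1.
  by case: k => [|[|k]]; [exact: ee|exact: eb|rewrite spine3 SabA eb].
elim/spine_parity: m => [//|||m IH].
- exact: lJ.
- by rewrite spine3 => /(lJ _ a); rewrite SabA e_spine.
- by rewrite spine3 => /(lJ _ a); rewrite SabA e_spine; apply: IH.
Qed.

Lemma kernel_minimal : minimal_ideal (~` A).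
Proof.
split=> [|J [[x Jx] rJ lJ] [_]]; first exact: kernel_ideal.
apply=> y /kernelP <-; apply: (rJ).
have [m [j xE]] := spine_form x; rewrite xE in Jx.
apply: (left_ideal_spine J m lJ).
by apply: (right_ideal_spine J m j m.+1 0) => //; rewrite leqnn.
Qed.

(** The element [b a^N] lies in the right ideal of [eS] of index [N + 1] but
    not in the one of index [N]; these are right ideals because [e] sends every
    state [BApow j] to [Sink]. *)
Lemma kernel_not_right_noetherian (hK : subsemigroup (~` A)) :
  ~ right_noetherian (sub_semigroup hK).
Proof.
pose st (x : sub_semigroup hK) := act (Apow 0) (val x).
pose I n := [set x | st x = Sink \/ exists2 j, (j < n)%N & st x = BApow j].
move=> /(_ I) [n x y Ix|n x [Ix|[j jn Ix]]|N Istab].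
- left; rewrite /st.
  have -> : val (x * y) = val x * val y by [].
  have /kernelP <- := set_mem (valP y).
  by rewrite act_mul; case: Ix => [|[j _]]; rewrite /st => ->;
    rewrite ?act_Sink ?act_e_BApow.
- by left.
- by right; exists j => //; apply: ltnW.
have Kx : run b (pow_a N) \in ~` A.
  apply/mem_set/(right_ideal_run (~` A)); first by case: kernel_ideal.
  exact/kernelP/eb.
pose x : sub_semigroup hK := exist (fun y => y \in ~` A) _ Kx.
have stx : st x = BApow N.
  rewrite /st -[val x]/(run b (pow_a N)).
  suff h k y : act (Apow 0) y = BApow k ->
      act (Apow 0) (run y (pow_a N)) = BApow (N + k).
    by rewrite (h 0) ?addn0 // act_b.
  elim: N {Istab Kx x} k y => //= N IH k y yk.
  by rewrite (IH k.+1) ?addnS // act_mul yk act_a.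
have : I N.+1 x by right; exists N.
rewrite Istab // => -[|[j jN]]; rewrite stx // => -[Nj].
by rewrite Nj ltnn in jN.
Qed.

End Proof.

Theorem mainTheorem2 :
  (exists hK : minimal_ideal (~` gen_subsemigroup [set Sab_a]),
    right_noetherian Sab /\
    ~ right_noetherian (sub_semigroup (minimal_ideal_subsemigroup hK)))
  /\
  (exists (T : semigroupType) (K : set T) (hK : minimal_ideal K),
    right_noetherian T /\
    ~ right_noetherian (sub_semigroup (minimal_ideal_subsemigroup hK))).
Proof.
have SabK := conj right_noetherian_Sab (kernel_not_right_noetherian
  (minimal_ideal_subsemigroup kernel_minimal)).
by split; [exists kernel_minimal|exists Sab, _, kernel_minimal].
Qed.
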